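(* Let $\pi$ be a set of primes and let $G$ be a finite $\pi$-separable group. Then $l_\pi(G/Z(G)) \leq \epsilon_\pi(G)$.
   Context: $Z(G)$ is the center of $G$. Let $\pi$ be a set of primes and $\pi'$ the complementary set of primes. A finite group is $\pi$-separable if it has a normal series each of whose factors is either a $\pi$-group or a $\pi'$-group. For a finite group $H$, $O_\pi(H)$ and $O_{\pi'}(H)$ denote the largest normal $\pi$-subgroup and the largest normal $\pi'$-subgroup of $H$. The upper $\pi$-series of a $\pi$-separable group $H$ is $1=P_0\leq K_0< P_1< K_1<\ldots<P_l\leq K_l=H$, where $K_i/P_i=O_{\pi'}(H/P_i)$ and $P_{i+1}/K_i=O_\pi(H/K_i)$; the $\pi$-length $l_\pi(H)$ is the number $l$, i.e. the least integer $l\ge 0$ such that $K_l=H$. For a natural number $n$, $\exp_\pi(n)$ is the number of prime factors of $n$ belonging to $\pi$, counted with multiplicity (i.e. if the $\pi$-part of $n$ is $p_1^{k_1}\cdots p_s^{k_s}$ with distinct primes $p_i\in\pi$, then $\exp_\pi(n)=k_1+\ldots+k_s$). For $x\in H$, $x^H$ is the conjugacy class of $x$ in $H$, $\epsilon_\pi(x)=\exp_\pi(|x^H|)$, and $\epsilon_\pi(H)=\max\{\epsilon_\pi(x): x\in H\}$. *)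

(* Defs.v *)
From mathcomp Require Import all_boot all_fingroup all_solvable.

Set Implicit Arguments.
Unset Strict Implicit.
Unset Printing Implicit Defensive.

Local Open Scope group_scope.

(* Following the convention of prime.v and pgroup.v, a set of primes is a     *)
(* nat_pred; its non-prime elements never play a role below.                  *)

Section PiSeparable.

Variables (gT : finGroupType) (pi : nat_pred).
Implicit Types (A B G : {set gT}).

(* G.-invariant.-series chains have all their terms normalised by G; together *)
(* with last 1 s = G below, this makes every term a normal subgroup of G.     *)
Definition pi_factor G : rel {set gT} := fun A B =>
  invariant_factor G A B && (pi.-group (B / A) || pi^'.-group (B / A)).

Definition pi_separable (G : {group gT}) : Prop :=
  exists2 s : seq {group gT},
    (pi_factor G).-series 1%G s & last 1%G s = G.

(* The term K_l = 'O_{pi^', pi, pi^', ..., pi, pi^'}(G) of the upper          *)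
(* pi-series, with l occurrences of pi.                                       *)
Definition upper_pi_series l G :=
  pseries (pi^' :: flatten (nseq l [:: pi; pi^'])) G.

(* The bound #|G| is harmless for pi-separable groups: see pi_lengthP below.  *)
Definition pi_length G :=
  find (fun l => upper_pi_series l G == G) (iota 0 #|G|.+1).

End PiSeparable.

Definition exp_pi (pi : nat_pred) (n : nat) : nat :=
  \sum_(p <- primes n | p \in pi) logn p n.

Definition epsilon_pi (gT : finGroupType) (pi : nat_pred) (G : {set gT}) : nat :=
  \max_(x in G) exp_pi pi #|x ^: G|.

Section PiLength.

Variables (gT : finGroupType) (pi : nat_pred).
Implicit Types (G : {group gT}).

Lemma upper_pi_seriesS l G :
  upper_pi_series pi l.+1 G
    = pcore_mod G pi^' (pcore_mod G pi (upper_pi_series pi l G)).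
Proof.
have E : flatten (nseq l.+1 [:: pi : nat_pred; pi^']) =
         rcons (rcons (flatten (nseq l [:: pi : nat_pred; pi^'])) pi) pi^'.
  by elim: l => //= l IHl; rewrite -IHl.
by rewrite /upper_pi_series E -!rcons_cons !pseries_rcons.
Qed.

Lemma upper_pi_series_stable l G :
  pi_separable pi G ->
  upper_pi_series pi l.+1 G = upper_pi_series pi l G ->
  upper_pi_series pi l G = G.
Proof.
case=> s sP lastG eqK.
pose K := pseries_group (pi^' :: flatten (nseq l [:: pi : nat_pred; pi^'])) G.
have nsKG : K <| G by apply: pseries_normal.
have nKG := normal_norm nsKG.
have EK : upper_pi_series pi l G = K by [].
move: eqK; rewrite upper_pi_seriesS EK => eqK.
pose P := pcore_mod_group G pi K.
have sKP : K \subset P by apply: sub_cosetpre.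
have sPK : P \subset K.
  have: P \subset pcore_mod G pi^' P by apply: sub_cosetpre.
  by rewrite eqK.
have ePK : pcore_mod G pi K = K by apply/eqP; rewrite eqEsubset sPK sKP.
have Opi : 'O_pi(G / K) = 1 by rewrite -quotient_pcore_mod ePK trivg_quotient.
have Opi' : 'O_pi^'(G / K) = 1.
  by rewrite -quotient_pcore_mod -[in pcore_mod _ _ _]ePK eqK trivg_quotient.
suff sLK : last 1%G s \subset K.
  by apply/eqP; rewrite eqEsubset normal_sub //=; move: sLK; rewrite lastG.
have sG : all (fun H : {group gT} => H \subset last 1%G s) (1%G :: s).
  elim: s (1%G : {group gT}) sP {lastG sKP sPK ePK} => [|B s IHs] A /=; first by rewrite subxx.
  case/andP=> /andP[/and3P[_ _ /andP[sAB _]] _] /IHs /= /andP[sB ->].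
  by rewrite sB (subset_trans sAB sB).
rewrite lastG in sG.
have: (1%G : {group gT}) \subset K by apply: sub1G.
elim: s (1%G : {group gT}) sP sG {lastG} => [|B s IHs] A //=.
case/andP=> /andP[/and3P[nAG nBG nsAB] piBA] sP /and3P[sAG sBG sG] sAK.
apply: (IHs B sP); first by rewrite /= sBG.
have nKB := subset_trans sBG nKG.
rewrite -quotient_sub1 //.
have nsBKG : B / K <| G / K by rewrite quotient_normal // /normal sBG.
have dvd : #|B / K| %| #|B / A|.
  rewrite !card_quotient ?(normal_norm nsAB) // -indexgI.
  by rewrite indexgS // subsetI (normal_sub nsAB).
by case/orP: piBA => /(pnat_dvd dvd) ?; [rewrite -Opi | rewrite -Opi']; apply: pcore_max.
Qed.

Lemma pi_length_has G :
  pi_separable pi G ->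
  has (fun l => upper_pi_series pi l G == G) (iota 0 #|G|.+1).
Proof.
move=> sepG; apply/negPn/negP => /hasPn noK.
have lt l : l <= #|G| -> l < #|upper_pi_series pi l G|.
  elim: l => [|l IHl] le_l; first exact: cardG_gt0.
  apply: leq_ltn_trans (IHl (ltnW le_l)) _.
  have ss : upper_pi_series pi l G \subset upper_pi_series pi l.+1 G.
    rewrite upper_pi_seriesS.
    set K := upper_pi_series pi l G.
    apply: (@subset_trans _ _ (pcore_mod G pi K)); apply: sub_cosetpre.
  apply: proper_card; rewrite properEneq ss andbT.
  apply/eqP=> /esym /(upper_pi_series_stable sepG) E.
  by have := noK l; rewrite mem_iota add0n ltnS (ltnW le_l) E eqxx => /(_ isT).
have := lt _ (leqnn _); rewrite ltnNge subset_leq_card //.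
exact: pseries_sub.
Qed.

Lemma pi_lengthP G :
  pi_separable pi G ->
  upper_pi_series pi (pi_length pi G) G = G /\
  (forall l, upper_pi_series pi l G = G -> pi_length pi G <= l).
Proof.
move/pi_length_has => hK; split.
  have := nth_find 0 hK; rewrite nth_iota ?add0n; first by move/eqP.
  by rewrite -[X in _ < X](size_iota 0) -has_find.
move=> l Kl; rewrite leqNgt; apply/negP => lt_l.
have := before_find 0 lt_l; rewrite nth_iota ?add0n ?Kl ?eqxx //.
apply: leq_trans lt_l _; rewrite -[X in _ <= X](size_iota 0); exact: find_size.
Qed.

End PiLength.

(* Main.v *)
Require Import Defs.
From mathcomp Require Import all_boot all_fingroup all_solvable.

Set Implicit Arguments.
Unset Strict Implicit.
Unset Printing Implicit Defensive.

Local Open Scope group_scope.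

(* Put G1 = G / 'O_pi^'(G) and G2 = G1 / 'O_pi(G1). By the Hall-Higman        *)
(* argument an element of G1 outside 'O_pi(G1) does not centralise 'O_pi(G1), *)
(* so its class size has one more prime factor in pi than that of its image   *)
(* in G2. Descending the upper pi-series in this way, a nontrivial element of *)
(* the last section gains one factor per layer, which is one short of the     *)
(* pi-length. The missing factor comes from a group G with 'O_pi(G) = 1 that  *)
(* is not a pi^'-group: if all its class sizes were pi^'-numbers, then every  *)
(* class in Q = 'O_pi^'(G) of T = 'O_{pi^', pi}(G) would be a single Q-class, *)
(* on which a p-element of T (p in pi) has a fixed point; so the centraliser  *)
(* of this p-element meets every class of Q and contains Q, against           *)
(* Hall-Higman. This needs at least one pi-layer below the last one; when the *)
(* pi-length of G / 'Z(G) is 1 the same fixed-point argument applies to a     *)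
(* Sylow subgroup acting on the classes of G itself.                          *)

(** Lifting a nontrivial element through a pi^'-layer and a pi-layer adds a prime of [pi] to its
    class size ([exp_pi_class_lift2]). If the pi-core is trivial, the last section still supplies
    one such prime ([exp_pi_class_gt0]), so induction yields a class whose exponent reaches the
    pi-length ([upper_pi_series_exp_pi]). If [G / 'Z(G)] has pi-length at least 2, removing its two
    bottom layers leaves a group with trivial pi-core, and one more lift makes up for the removed
    pi-layer. In pi-length 1 the centre matters: class sizes that are all pi^'-numbers force
    [G / 'Z(G)] to be a pi^'-group ([pgroup_quotient_center]). *)

(* The conjugates of H cover at most #|G : H| * #|H^#| = #|G| - #|G : H|      *)
(* nontrivial elements.                                                       *)
Lemma class_support_eq (gT : finGroupType) (G H : {group gT}) :
  H \subset G -> G \subset class_support H G -> H :=: G.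
Proof.
move=> sHG sGcl; apply/eqP; rewrite eqEcard sHG /=.
have sG1: G^# \subset cover (H^# :^: G).
  apply/subsetP=> x /setD1P[ntx /(subsetP sGcl)].
  rewrite cover_imset -class_supportEr => /imset2P[y z Hy Gz def_x].
  rewrite def_x memJ_class_support // !inE Hy andbT.
  by apply: contraNneq ntx => y1; rewrite def_x y1 conj1g.
have:= leq_trans (subset_leq_card sG1) (leq_card_cover _).
rewrite (eq_bigr (fun=> #|H^#|)) => [|_ /imsetP[y _ ->]]; last by rewrite cardJg.
rewrite sum_nat_const card_conjugates => le1.
have{le1}: #|G^#| <= #|G : H| * #|H^#|.
  apply: leq_trans le1 _; rewrite leq_mul2r dvdn_leq ?orbT //.
  rewrite -[X in X %| _]indexgI; apply: indexgS; rewrite subsetI sHG /=.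
  by rewrite subsetI sHG (subset_trans (normG H)) ?normD1.
have cardD1 (K : {group gT}): #|K| = #|K^#|.+1.
  by rewrite (cardsD1 1 K) group1.
(* Adding [#|G : H|] to both sides bounds [#|G^#| + #|G : H|] by [#|G|], whence [#|G : H| <= 1]. *)
rewrite -(leq_add2r #|G : H|) -{3}(muln1 #|G : H|) -mulnDr addn1 -cardD1.
rewrite (mulnC _ #|H|) Lagrange // {1}cardD1 -(addn1 #|G^#|) leq_add2l => le1.
by rewrite -(Lagrange sHG) -[X in _ <= X]muln1 leq_mul2l le1 orbT.
Qed.

(** The p-group [P] acts on each [x ^: Q], whose size is prime to p, hence fixes a point; so
    ['C_Q(P)] meets every class of [Q]. *)
Lemma coprime_class_cent (gT : finGroupType) (p : nat) (P Q : {group gT}) :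
    prime p -> p.-group P -> P \subset 'N(Q) ->
    {in Q, forall x, ~~ (p %| #|x ^: Q|) /\ {in P, forall a, x ^ a \in x ^: Q}} ->
  P \subset 'C(Q).
Proof.
move=> p_pr pP nQP clQ; suff /setIidPl cQP: 'C_Q(P) = Q.
  by rewrite centsC.
apply: class_support_eq (subsetIl _ _) _; apply/subsetP=> x Qx.
have [p'x Px] := clQ x Qx.
have actP: [acts P, on x ^: Q | 'J].
  apply/subsetP=> a Pa; rewrite !inE; apply/subsetP=> _ /imsetP[q Qq ->].
  rewrite inE /= conjJg; have /imsetP[r Qr ->] := Px a Pa.
  by rewrite -conjgM memJ_class // groupM // memJ_norm // (subsetP nQP).
have: ~~ (p %| #|'Fix_(x ^: Q | 'J)(P)|).
  by rewrite /dvdn -(pgroup_fix_mod pP actP).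
case: (set_0Vmem 'Fix_(x ^: Q | 'J)(P)) => [-> | [y]].
  by rewrite cards0 dvdn0.
rewrite afixJ => /setIP[/imsetP[q Qq ->] cPxq] _.
by rewrite -(conjgK q x) memJ_class_support ?groupV // inE groupJ.
Qed.

(** Split [#|G : 'C_G[x]|] at [M <*> 'C_G[x]]: the lower index is [#|M : 'C_M[x]|], and the image of
    this join in [G / M] centralises [coset M x]. *)
Lemma dvdn_card_class (gT : finGroupType) (G M : {group gT}) x :
    M <| G -> x \in G ->
  #|coset M x ^: (G / M)| * #|M : 'C_M[x]| %| #|x ^: G|.
Proof.
move=> nsMG Gx; have [sMG nMG] := andP nsMG; rewrite -!index_cent1.
have nMC: 'C_G[x] \subset 'N(M) by rewrite subIset ?nMG.
have sMCG: M <*> 'C_G[x] \subset G by rewrite join_subG sMG subsetIl.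
rewrite -(Lagrange_index sMCG (joing_subr _ _)) dvdn_mul //.
  rewrite -(index_quotient_eq _ sMCG nMG); last first.
    by rewrite subIset // joing_subl orbT.
  apply: indexgS; rewrite subsetI quotientS //=.
  by rewrite quotientYidl // morphim_cent1s ?subsetIr // (subsetP nMG).
rewrite /= norm_joinEr // -normC // indexMg -(indexgI M).
by rewrite setIA (setIidPl sMG).
Qed.

(** * Arithmetic of [exp_pi] *)

Section ExpPi.

Variable pi : nat_pred.

(** A range independent of [n] lets the sums for two numbers and their product be compared
    termwise. *)
Lemma exp_piE n m : 0 < n <= m ->
  exp_pi pi n = \sum_(0 <= p < m.+1 | p \in pi) logn p n.
Proof.
case/andP=> n0 le_nm; rewrite /exp_pi big_mkcond [RHS]big_mkcond /=.
rewrite [RHS](bigID (mem (primes n))) /= [X in _ = _ + X]big1 => [|p].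
  rewrite addn0 -[RHS]big_filter; apply: perm_big; apply: uniq_perm.
  - exact: primes_uniq.
  - by rewrite filter_uniq // iota_uniq.
  move=> p; rewrite mem_filter mem_index_iota /= andbC; case pn: (p \in _); last by rewrite andbF.
  move: pn; rewrite mem_primes n0 => /and3P[_ _ pn].
  by rewrite ltnS (leq_trans (dvdn_leq n0 pn)).
by rewrite -logn_gt0 -eqn0Ngt => /eqP->; rewrite if_same.
Qed.

Lemma exp_piM m n : 0 < m -> 0 < n ->
  exp_pi pi (m * n) = exp_pi pi m + exp_pi pi n.
Proof.
move=> m0 n0; have mn0: 0 < m * n by rewrite muln_gt0 m0.
rewrite !(@exp_piE _ (m * n)) ?mn0 ?m0 ?n0 ?leq_pmulr ?leq_pmull //=.
by rewrite -big_split; apply: eq_bigr => p _; rewrite lognM.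
Qed.

Lemma exp_pi_dvd m n : 0 < n -> m %| n -> exp_pi pi m <= exp_pi pi n.
Proof.
move=> n0 /dvdnP[k def_n]; move: n0; rewrite def_n muln_gt0 => /andP[k0 m0].
by rewrite exp_piM // leq_addl.
Qed.

Lemma exp_pi_eq0 n : 0 < n -> (exp_pi pi n == 0) = pi^'.-nat n.
Proof.
move=> n0; rewrite /exp_pi sum_nat_seq_eq0 /pnat n0 /=.
apply: eq_in_all => p pn; rewrite inE /=.
by rewrite eqn0Ngt logn_gt0 pn implybF.
Qed.

End ExpPi.

(** * Pi-separable groups and the Hall-Higman lemma *)

Lemma pi_separableC (gT : finGroupType) pi (G : {group gT}) :
  pi_separable pi G -> pi_separable pi^' G.
Proof.
case=> s sP lastG; exists s => //; apply: sub_path sP => A B /=.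
by rewrite /pi_factor pgroupNK orbC.
Qed.

Lemma pi_separable_quotient (gT : finGroupType) pi (G N : {group gT}) :
  N <| G -> pi_separable pi G -> pi_separable pi (G / N).
Proof.
move=> nsNG [s sP lastG]; have nNG := normal_norm nsNG.
have sG: all (fun A : {group gT} => A \subset last 1%G s) (1%G :: s).
  elim: s (1%G : {group gT}) sP {lastG} => [|B s IHs] A /=; first by rewrite subxx.
  case/andP=> /andP[/and3P[_ _ /andP[sAB _]] _] /IHs /= /andP[sB ->].
  by rewrite sB (subset_trans sAB sB).
exists (map (fun A : {group gT} => A / N)%G s); last first.
  have E1: (1 / N)%G = 1%G by apply/val_inj; apply: quotient1.
  by rewrite -E1 last_map lastG.
have: 1%G = (1 / N)%G by apply/val_inj; rewrite /= quotient1.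
rewrite lastG in sG.
move: (1%G : {group coset_of N}) => ? ->.
elim: s (1%G : {group gT}) sP sG {lastG} => [|B s IHs] A //=.
case/andP=> /andP[/and3P[nAG nBG nsAB] piBA] sP /and3P[sAG sBG sG].
rewrite IHs //= ?sBG // andbT /pi_factor /invariant_factor.
rewrite !quotient_norms ?quotient_normal //=.
have nNB := subset_trans sBG nNG.
have dvd : #|B / N / (A / N)| %| #|B / A|.
  rewrite !card_quotient ?(normal_norm nsAB) ?quotient_norms ?normal_norm //.
  by rewrite index_quotient // subIset // nNB.
by case/orP: piBA => /(pnat_dvd dvd) h; apply/orP; [left | right].
Qed.

(** If a term [A] of the series meets [N] trivially, then [B :&: N] for the next term [B] embeds in
    [B / A], so it is a normal pi- or pi^'-subgroup of [N], hence trivial. *)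
Lemma pi_separable_pcore (gT : finGroupType) pi (G N : {group gT}) :
  pi_separable pi G -> N <| G -> 'O_pi(N) = 1 -> 'O_pi^'(N) = 1 -> N :=: 1.
Proof.
move=> [s sP lastG] nsNG Opi Opi'; have [sNG nNG] := andP nsNG.
suff: last 1%G s :&: N = 1 by rewrite lastG (setIidPr sNG).
have: (1%G : {group gT}) :&: N = 1 by apply: setI1g.
elim: s (1%G : {group gT}) sP {lastG} => [|B s IHs] A //=.
case/andP=> /andP[/and3P[nAG nBG nsAB] piBA] sP tiAN.
apply: (IHs B sP).
have nsBN: B :&: N <| N by rewrite /normal subsetIr normsI ?normG // (subset_trans sNG).
have dvd : #|B :&: N| %| #|B / A|.
  have tiBNA : B :&: N :&: A = 1.
    by apply/trivgP; rewrite -tiAN /= -setIA (setIC N) subsetIr.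
  rewrite /= -(indexg1 (B :&: N)) -tiBNA indexgI -card_quotient ?cardSg ?quotientS ?subsetIl //.
  by rewrite subIset // normal_norm.
apply/trivgP.
by case/orP: piBA => /(pnat_dvd dvd) ?; [rewrite -Opi | rewrite -Opi']; apply: pcore_max.
Qed.

(** Hall-Higman: [C / Z], with [Z = 'Z(O)], has trivial pi- and pi^'-cores, so it is trivial and
    [C = Z] lies in [O]. *)
Lemma pi_separable_cent_pcore (gT : finGroupType) pi (G : {group gT}) :
  pi_separable pi G -> 'O_pi^'(G) = 1 -> 'C_G('O_pi(G)) \subset 'O_pi(G).
Proof.
move=> sepG Opi'; set O := 'O_pi(G); set C := 'C_G(O); pose Z := 'Z(O).
have nsOG: O <| G := pcore_normal _ _.
have nsCG: C <| G by rewrite /normal subsetIl normsI ?normG ?norms_cent ?normal_norm.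
have nsZG: Z <| G := gFnormal_trans _ nsOG.
have sZC : Z \subset C.
  by rewrite subsetI normal_sub //= subsetIr.
have sZO : Z \subset O := center_sub _.
have nZC: C \subset 'N(Z) by rewrite subIset // normal_norm.
suff trOC rho (rho_pi : rho = pi \/ rho = pi^' :> nat_pred): 'O_rho(C / Z) = 1.
  have sepGZ := pi_separable_quotient nsZG sepG.
  have trCZ := pi_separable_pcore sepGZ (quotient_normal Z nsCG).
  by rewrite (subset_trans _ sZO) // -quotient_sub1 // trCZ ?trOC; auto.
pose M := (coset Z @*^-1 'O_rho(C / Z))%G.
have defM : M / Z = 'O_rho(C / Z) by apply: cosetpreK.
have nsMG : M <| G.
  rewrite -(quotientGK nsZG) cosetpre_normal gFnormal_trans //.
  by rewrite quotient_normal.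
have sZM : Z \subset M by apply: sub_cosetpre.
have sMC : M \subset C.
  have defC : coset Z @*^-1 (C / Z) = C.
    by apply: quotientGK; rewrite /normal sZC.
  by rewrite -defC morphpreS ?pcore_sub.
have nZM := subset_trans sMC nZC.
have rhoMZ : rho.-group (M / Z) by rewrite defM pcore_pgroup.
have piZ : pi.-group Z := pgroupS sZO (pcore_pgroup _ _).
apply/trivgP; rewrite /= -defM quotient_sub1 //.
case: rho_pi => def_rho; rewrite def_rho in rhoMZ.
  (* Here [M] is a normal pi-subgroup of [G] that centralises [O], so it lies in [Z]. *)
  rewrite subsetI pcore_max // -?(pquotient_pgroup piZ nZM) //.
  by rewrite (subset_trans sMC) ?subsetIr.
(* The central Hall subgroup Z splits off M with a complement in 'O_pi^'(G). *)
have hallZ : pi.-Hall(M) Z.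
  by rewrite /pHall sZM piZ -card_quotient.
have nsZM : Z <| M by rewrite /normal sZM.
have [K /complP[tiZK defZK]] := splitsP (SchurZassenhaus_split (pHall_Hall hallZ) nsZM).
have sKM : K \subset M by rewrite -defZK mulG_subr.
have cZM : M \subset 'C(Z).
  by apply: subset_trans sMC _; apply: subset_trans (subsetIr _ _) (centS sZO).
have nsKM : K <| M.
  rewrite /normal sKM -defZK mulG_subG normG andbT cents_norm // centsC.
  exact: subset_trans cZM.
have pi'K : pi^'.-group K.
  rewrite /pgroup -(mulKn #|K| (cardG_gt0 Z)) -TI_cardMg // defZK.
  by rewrite divgS // -card_quotient.
have: K \subset 'O_pi^'(G).
  apply: subset_trans (pcore_max pi'K nsKM) _.
  by rewrite pcore_max ?pcore_pgroup ?gFnormal_trans.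
by rewrite Opi' => /trivgP K1; rewrite -defZK K1 mulg1.
Qed.

(** * Class sizes along the upper pi-series *)

Lemma exp_pi_class_lift (gT : finGroupType) pi (G : {group gT}) x :
    pi_separable pi G -> 'O_pi^'(G) = 1 -> x \in G -> x \notin 'O_pi(G) ->
  exp_pi pi #|coset 'O_pi(G) x ^: (G / 'O_pi(G))| < exp_pi pi #|x ^: G|.
Proof.
move=> sepG Opi' Gx notOx; set O := 'O_pi(G).
have nsOG : O <| G := pcore_normal _ _.
have xG0 : 0 < #|x ^: G| by rewrite -index_cent1.
apply: leq_trans (exp_pi_dvd _ xG0 (dvdn_card_class nsOG Gx)).
rewrite exp_piM ?indexg_gt0 // -?index_cent1 ?indexg_gt0 // -addn1 leq_add2l.
(* The gain is [#|O : 'C_O[x]|], a pi-number that is not 1 because [x] does not centralise [O]. *)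
rewrite lt0n exp_pi_eq0 ?indexg_gt0 //.
have piO : pi.-nat #|O : 'C_O[x]| := pnat_dvd (dvdn_indexg _ _) (pcore_pgroup _ _).
apply: contra notOx => pi'O; have /eqP := pnat_1 piO pi'O.
rewrite indexg_eq1 subsetI subxx sub_cent1 => cOx.
by rewrite (subsetP (pi_separable_cent_pcore sepG Opi')) // inE Gx.
Qed.

Lemma exp_pi_class_quotient (gT : finGroupType) pi (G N : {group gT}) x :
    N <| G -> x \in G ->
  exp_pi pi #|coset N x ^: (G / N)| <= exp_pi pi #|x ^: G|.
Proof.
move=> nsNG Gx; have xG0 : 0 < #|x ^: G| by rewrite -index_cent1.
by apply: exp_pi_dvd => //; apply: dvdn_trans (dvdn_card_class nsNG Gx); apply: dvdn_mulr.
Qed.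

Lemma exp_pi_class_gt0 (gT : finGroupType) pi (G : {group gT}) :
    pi_separable pi G -> 'O_pi(G) = 1 -> 'O_pi^'(G) != G ->
  exists2 x, x \in G^# & 0 < exp_pi pi #|x ^: G|.
Proof.
move=> sepG Opi; set Q := 'O_pi^'(G) => ltQG.
have nsQG : Q <| G := pcore_normal _ _.
have Opi'' : 'O_pi^'^'(G) = 1 by rewrite (eq_pcore _ (negnK pi)).
apply/exists_inP; apply: contraR ltQG => /exists_inPn no_x.
have{no_x} pi'cl x : x \in G -> pi^'.-nat #|x ^: G|.
  have [-> _ | ntx Gx] := eqVneq x 1; first by rewrite class1G cards1.
  rewrite -exp_pi_eq0 -?index_cent1 // index_cent1 eqn0Ngt no_x //.
  by rewrite !inE ntx.
pose T := pcore_mod_group G pi Q.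
have nsTG : T <| G.
  by rewrite -(quotientGK nsQG) cosetpre_normal pcore_normal.
have sQT : Q \subset T by apply: sub_cosetpre.
have [sTG nTG] := andP nsTG.
have nQT : T \subset 'N(Q) := subset_trans sTG (normal_norm nsQG).
have piTQ : pi.-group (T / Q) by rewrite quotient_pcore_mod pcore_pgroup.
have sTQ : T \subset Q.
  have cQ: pi^'.-group T.
    apply/pgroupP=> p p_pr /Cauchy[] // a Ta oa; apply/negP=> pi_p.
    (* Hall-Higman for [pi^'] puts the centraliser of [Q] inside the pi^'-group [Q], which has no
       element of order p. *)
    suff: a \in 'C_G(Q).
      move/(subsetP (pi_separable_cent_pcore (pi_separableC sepG) Opi'')).
      by move/(mem_p_elt (pcore_pgroup _ _)); rewrite /p_elt oa pnatE // => /negP[].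
    rewrite inE (subsetP sTG) //= -cycle_subG.
    apply: (@coprime_class_cent _ p) => //.
    - by rewrite /pgroup -orderE oa pnat_id.
    - by rewrite cycle_subG (subsetP nQT).
    move=> x Qx; have Tx := subsetP sQT x Qx.
    have pi'CTx : pi^'.-nat #|T : 'C_T[x]|.
      apply: pnat_dvd (pi'cl x (subsetP sTG x Tx)).
      exact: dvdn_trans (dvdn_mull _ _) (dvdn_card_class nsTG (subsetP sTG x Tx)).
    (* #|T : Q <*> 'C_T[x]| is both a pi- and a pi^'-number. *)
    have eqcl : x ^: T = x ^: Q.
      have sQCT : Q <*> 'C_T[x] \subset T by rewrite join_subG sQT subsetIl.
      have pi'QC : pi^'.-nat #|T : Q <*> 'C_T[x]|.
        by apply: pnat_dvd pi'CTx; apply: indexgS (joing_subr _ _).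
      have piQC : pi.-nat #|T : Q <*> 'C_T[x]|.
        apply: (@pnat_dvd _ #|T / Q|); last exact: piTQ.
        by rewrite card_quotient //; apply: indexgS (joing_subl _ _).
      have /eqP := pnat_1 piQC pi'QC; rewrite indexg_eq1.
      have nQCT : 'C_T[x] \subset 'N(Q) by rewrite subIset ?nQT.
      rewrite /= norm_joinEr // -normC // => sTCQ.
      apply/eqP; rewrite eqEsubset andbC imsetS //=.
      apply/subsetP=> _ /imsetP[t /(subsetP sTCQ)/mulsgP[c q /setIP[_ xc] Qq ->] ->].
      by rewrite conjgM {2}/conjg -(cent1P xc) mulKg memJ_class.
    rewrite -eqcl; split=> [|b ab].
      rewrite -index_cent1; apply/negP=> p_dv.
      by have := pnat_dvd p_dv pi'CTx; rewrite pnatE // inE /= pi_p.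
    by rewrite memJ_class // (subsetP _ b ab) // cycle_subG.
  by rewrite pcore_max.
have Opi1 : 'O_pi(G / Q) = 1.
  by apply/trivgP; rewrite /= -quotient_pcore_mod quotient_sub1.
have Opi1' : 'O_pi^'(G / Q) = 1 := trivg_pcore_quotient _ _.
have := pi_separable_pcore (pi_separable_quotient nsQG sepG) (normal_refl _) Opi1 Opi1'.
move/trivgP; rewrite quotient_sub1 ?normal_norm // => sGQ.
by rewrite eqEsubset normal_sub.
Qed.

(** Peels the bottom layer off a series; two uses remove a pi^'-layer and a pi-layer. *)
Lemma pseries_cons_eq (gT : finGroupType) rho pis (G : {group gT}) :
    pseries pis (G / 'O_rho(G)) = G / 'O_rho(G) ->
  pseries (rho :: pis) G = G.
Proof.
rewrite -pseries1 -quotient_pseries_cat /= => eqG.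
apply/eqP; rewrite eqEsubset pseries_sub /=.
rewrite -(quotientSGK _ (pseries_sub_catl [:: rho] pis G)) /= ?eqG //.
exact: normal_norm (pseries_normal _ _).
Qed.

Lemma exp_pi_class_lift2 (gT : finGroupType) pi (G : {group gT}) :
    pi_separable pi G -> let G1 := G / 'O_pi^'(G) in
  {in (G1 / 'O_pi(G1))^#, forall y,
    exists2 x, x \in G^# & exp_pi pi #|y ^: (G1 / 'O_pi(G1))| < exp_pi pi #|x ^: G|}.
Proof.
move=> sepG G1 y /setD1P[nty /morphimP[x1 Nx1 Gx1 def_y]].
have /morphimP[x Nx Gx def_x1] := Gx1.
have Ox1 : x1 \notin 'O_pi(G1).
  by apply: contra nty => /coset_id Ox1; rewrite def_y /= Ox1.
exists x.
  rewrite !inE Gx andbT; apply: contraNneq Ox1 => x1'.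
  by rewrite def_x1 x1' morph1 group1.
have nsOG : 'O_pi^'(G) <| G := pcore_normal _ _.
apply: leq_trans (exp_pi_class_quotient pi nsOG Gx).
rewrite def_y -[coset _ x]def_x1; apply: exp_pi_class_lift => //.
  exact: pi_separable_quotient.
exact: trivg_pcore_quotient.
Qed.

(** The quotient [G1 / 'O_pi(G1)] again has trivial pi-core, so the induction continues. *)
Lemma upper_pi_series_exp_pi (gT : finGroupType) pi l (G : {group gT}) :
    pi_separable pi G -> 'O_pi(G) = 1 -> upper_pi_series pi l G != G ->
  exists2 x, x \in G^# & l < exp_pi pi #|x ^: G|.
Proof.
elim: l => [|l IHl] in gT G * => sepG Opi.
  by rewrite /upper_pi_series pseries1; apply: exp_pi_class_gt0.
move=> neqG; set G1 := (G / 'O_pi^'(G))%G.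
have sepG1 : pi_separable pi G1 by apply: pi_separable_quotient (pcore_normal _ _) _.
have [|||y G2y lt_l_y] := IHl _ (G1 / 'O_pi(G1))%G.
- exact: pi_separable_quotient (pcore_normal _ _) _.
- exact: trivg_pcore_quotient.
- by apply: contraNneq neqG => eqG; apply/eqP; do 2!apply: pseries_cons_eq.
have [x Gx lt_y_x] := exp_pi_class_lift2 sepG G2y.
by exists x => //; apply: leq_trans lt_y_x.
Qed.

(** For p in [pi], [coprime_class_cent] with [Q = G] makes a Sylow p-subgroup central. *)
Lemma pgroup_quotient_center (gT : finGroupType) pi (G : {group gT}) :
  {in G, forall x, pi^'.-nat #|x ^: G|} -> pi^'.-group (G / 'Z(G)).
Proof.
move=> pi'G; have nZG : G \subset 'N('Z(G)) := normal_norm (center_normal G).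
apply/pgroupP=> p p_pr; rewrite card_quotient // => p_dv; apply/negP=> /= pi_p.
have [S sylS] := Sylow_exists p G; have [sSG pS p'GS] := and3P sylS.
suff sSZ : S \subset 'Z(G).
  by have := pnat_dvd (dvdn_trans p_dv (indexgS G sSZ)) p'GS; rewrite pnatE // !inE eqxx.
rewrite subsetI sSG; apply: (coprime_class_cent p_pr pS) => [|x Gx].
  exact: subset_trans sSG (normG G).
split=> [|a Sa]; last by rewrite memJ_class // (subsetP sSG).
by apply/negP=> p_x; have := pnat_dvd p_x (pi'G x Gx); rewrite pnatE // inE /= pi_p.
Qed.

Theorem theorem1p4 (gT : finGroupType) (pi : nat_pred) (G : {group gT})
    (sepG : pi_separable pi G) :
  pi_length pi (G / 'Z(G)) <= epsilon_pi pi G.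
Proof.
have nsZG : 'Z(G) <| G := center_normal G.
have sepGZ := pi_separable_quotient nsZG sepG.
have [_ min_len] := pi_lengthP sepGZ.
(* Length 0 is immediate; in the last case the length is [l.+2]: the section two layers up gives
   exponent above [l], and the lift adds one. *)
case def_l: (pi_length pi (G / 'Z(G))) => [|[|l]] //.
  rewrite ltnNge leqn0; apply/negP=> /eqP eps0.
  suff: pi_length pi (G / 'Z(G)) <= 0 by rewrite def_l.
  apply: min_len; rewrite /upper_pi_series pseries1 pcore_pgroup_id //.
  apply: pgroup_quotient_center => x Gx.
  rewrite -exp_pi_eq0 -?index_cent1 // index_cent1 -leqn0 -eps0.
  exact: (leq_bigmax_cond (F := fun x => exp_pi pi #|x ^: G|)).
pose G1 := (G / 'Z(G) / 'O_pi^'(G / 'Z(G)))%G.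
have sepG1 : pi_separable pi G1 by apply: pi_separable_quotient (pcore_normal _ _) _.
have [||| y G2y lt_l_y] := @upper_pi_series_exp_pi _ pi l (G1 / 'O_pi(G1))%G.
- exact: pi_separable_quotient (pcore_normal _ _) _.
- exact: trivg_pcore_quotient.
- apply/eqP=> eqG; suff: l.+1 < l.+1 by rewrite ltnn.
  by rewrite -def_l; apply: min_len; do 2!apply: pseries_cons_eq.
have [_ /setD1P[_ /morphimP[x Nx Gx ->]] lt_y_x] := exp_pi_class_lift2 sepGZ G2y.
apply: leq_trans (leq_bigmax_cond (F := fun x => exp_pi pi #|x ^: G|) _ Gx).
apply: leq_trans (exp_pi_class_quotient pi nsZG Gx).
exact: leq_trans lt_y_x.
Qed.
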